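(* Given any permutation $\delta=(\delta_1,\dots,\delta_n)$ of $[n]$, the lifting coefficients $\{\eta^\delta_{\delta_j}\}_{j\in[n]}$ can be computed in $O(n^2)$ time.
   Context: For a non-negative integer $m$, $[m]=\{1,\dots,m\}$ with $[0]=\varnothing$. Let $n,t$ be positive integers, $f:\mathbb{R}\to\mathbb{R}$ a concave function with $f(0)=0$, $a\in\mathbb{R}^n$ with non-negative entries, and $\{N_k\}_{k\in[t]}$ a partition of $[n]$ into consecutive blocks: with $i_0:=0$ and $i_k:=\sum_{j=1}^k|N_j|$, $N_k=\{i_{k-1}+1,\dots,i_k\}$. Within each block the entries of $a$ are ascending: $a_{i_{k-1}+1}\le\cdots\le a_{i_k}$ for all $k\in[t]$. For $S\subseteq[n]$, $a(S):=\sum_{i\in S}a_i$. For a permutation $\delta$ of $[n]$, let $\delta(j):=\{\delta_1,\dots,\delta_j\}$ and $\delta(0)=\varnothing$. The lifting coefficients are defined recursively for $j=1,\dots,n$ by $$\eta^{\delta}_{\delta_j}:=\min_{S}\Big\{ f(a(S))-\sum_{i\in S\setminus\{\delta_j\}}\eta^{\delta}_i \;:\; S\subseteq\delta(j),\ |S\cap N_k|\le 1\ \ \forall k\in[t],\ \delta_j\in S\Big\}.$$ Time is counted as the number of elementary operations (real arithmetic, comparisons, and evaluations of $f$ at a point, each at unit cost). *)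

(* Defs.v *)
From HB Require Import structures.
From mathcomp Require Import all_boot all_order all_algebra.
From mathcomp Require Import all_fingroup.
From mathcomp Require Import reals interval_inference convex.
From mathcomp Require classical_sets.

Set Implicit Arguments.
Unset Strict Implicit.
Unset Printing Implicit Defensive.

Import Order.TTheory GRing.Theory Num.Theory.
Local Open Scope ring_scope.

Definition concave_function (R : realType) (f : R -> R) : Prop :=
  @convex_function R R^o classical_sets.setT (fun x => - f x).

Lemma concave_functionP (R : realType) (f : R -> R) :
  concave_function f <->
  forall s x y : R, 0 <= s <= 1 ->
    s * f x + (1 - s) * f y <= f (s * x + (1 - s) * y).
Proof.
split=> [cf s x y /andP[s0 s1]|cf s x y _ _].
  have : - f (s * x + (1 - s) * y) <= s * - f x + (1 - s) * - f y.
    exact: (cf (Itv01 s0 s1) x y (classical_sets.in_setT _)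
      (classical_sets.in_setT _)).
  by rewrite !mulrN -opprD lerN2.
have : s%:num * f x + (1 - s%:num) * f y <=
    f (s%:num * x + (1 - s%:num) * y) by apply: cf; rewrite ge0 le1.
by rewrite -lerN2 opprD -!mulrN.
Qed.

Section Lifting.
Variables (R : realType) (n t : nat).
Implicit Types (f : R -> R) (a : 'I_n -> R) (N : 'I_t -> {set 'I_n}).
Implicit Types (d : {perm 'I_n}) (S : {set 'I_n}).

(* Indices are 0-based: the ground set is {0..n-1} and the blocks are         *)
(* N 0..N (t-1); [block_end N k] is i_k, for 0 <= k <= t.                     *)
Definition block_end N (k : nat) : nat := (\sum_(j < t | j < k) #|N j|)%N.

Definition consecutive_partition N : Prop :=
  partition [set N k | k : 'I_t] [set: 'I_n] /\
  forall (k : 'I_t) (i : 'I_n),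
    (i \in N k) = (block_end N k <= i < block_end N k.+1)%N.

Definition ascending_in_blocks N a : Prop :=
  forall (k : 'I_t) (i j : 'I_n),
    i \in N k -> j \in N k -> (i <= j)%N -> a i <= a j.

Definition feasible N d (j : 'I_n) S : bool :=
  [&& S \subset [set d i | i : 'I_n & (i <= j)%N],
      [forall k : 'I_t, #|S :&: N k| <= 1]%N & d j \in S].

Definition lift_obj f a d (j : 'I_n) (eta : 'I_n -> R) S : R :=
  f (\sum_(i in S) a i) - \sum_(i in S :\ d j) eta i.

(* The singleton {d j} is always feasible, so that starting the iterated      *)
(* minimum from its objective value does not change the minimum.              *)
Definition lift_min f a N d (j : 'I_n) (eta : 'I_n -> R) : R :=
  \big[Num.min / lift_obj f a d j eta [set d j]]_(S | feasible N d j S)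
    lift_obj f a d j eta S.

(* Coefficients of the first m elements of the permutation, 0 elsewhere.      *)
Fixpoint lifting_prefix f a N d (m : nat) : 'I_n -> R :=
  if m is m'.+1 then
    let eta := lifting_prefix f a N d m' in
    fun i => let j := (d^-1)%g i in
      if val j == m' then lift_min f a N d j eta else eta i
  else fun=> 0.

Definition lifting_coef f a N d : 'I_n -> R := lifting_prefix f a N d n.

Lemma lifting_prefix_stable f a N d m m' i :
  ((d^-1)%g i < m)%N -> (m <= m')%N ->
  lifting_prefix f a N d m' i = lifting_prefix f a N d m i.
Proof.
move=> im; elim: m' => [|m' IH]; first by case: m im.
rewrite leq_eqVlt => /predU1P[->//|mm'] /=.
by rewrite ltn_eqF ?IH// (leq_trans im).
Qed.

Lemma lifting_coefE f a N d (j : 'I_n) :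
  lifting_coef f a N d (d j) = lift_min f a N d j (lifting_coef f a N d).
Proof.
rewrite /lifting_coef (@lifting_prefix_stable _ _ _ _ j.+1) ?permK//.
rewrite /= permK eqxx /lift_min.
have E S : feasible N d j S ->
    lift_obj f a d j (lifting_prefix f a N d j) S =
    lift_obj f a d j (lifting_prefix f a N d n) S.
  move=> /and3P[/subsetP Sd _ _]; congr (_ - _); apply: eq_bigr => i.
  rewrite !inE => /andP[idj /Sd /imsetP[l]]; rewrite inE => lj il.
  rewrite [RHS](@lifting_prefix_stable _ _ _ _ j) ?(ltnW (ltn_ord j))//.
  rewrite il permK ltn_neqAle lj andbT.
  by apply: contra idj => /eqP/val_inj <-; rewrite il.
have F1 : feasible N d j [set d j].
  rewrite /feasible set11 andbT sub1set imset_f ?inE//=.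
  apply/forallP => k; apply: leq_trans (subset_leq_card (subsetIl _ _)) _.
  by rewrite cards1.
by rewrite (E _ F1); apply: eq_bigr => S /E.
Qed.

End Lifting.

(* The machine: a real RAM with structured control flow. A program is a       *)
(* finite term that contains no real constant other than 0 and 1; its memory  *)
(* consists of arrays of naturals, used for index computations, and arrays of *)
(* reals. Reals can be combined by field operations, compared, and passed to  *)
(* the oracle f, but never converted to naturals.                             *)
Inductive iexp : Type :=
  | INum of nat
  | IGet of nat & iexp                  (* array name, index *)
  | IAdd of iexp & iexp
  | ISub of iexp & iexp.                (* truncated *)

Inductive rexp : Type :=
  | RZero
  | ROne
  | RGet of nat & iexp
  | RAdd of rexp & rexp
  | RSub of rexp & rexp
  | RMul of rexp & rexp
  | RDiv of rexp & rexp                 (* x / 0 = 0 *)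
  | REval of rexp.                      (* oracle call *)

Inductive bexp : Type :=
  | ILe of iexp & iexp
  | RLe of rexp & rexp
  | BNot of bexp
  | BAnd of bexp & bexp.

Inductive cmd : Type :=
  | Skip
  | ISet of nat & iexp & iexp           (* array name, index, value *)
  | RSet of nat & iexp & rexp
  | Seq of cmd & cmd
  | If of bexp & cmd & cmd
  | While of bexp & cmd.

Record state (R : realType) : Type := State {
  imem : nat -> nat -> nat;             (* array name, index *)
  rmem : nat -> nat -> R
}.

Definition upd (T : Type) (m : nat -> nat -> T) (x i : nat) (v : T) :=
  fun y j => if (y == x) && (j == i) then v else m y j.

(* Every node of an expression costs one unit, including constants, memory    *)
(* accesses and index arithmetic.                                             *)
Fixpoint icost (e : iexp) : nat :=
  match e with
  | INum _ => 1%N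
  | IGet _ e1 => (icost e1).+1
  | IAdd e1 e2 | ISub e1 e2 => (icost e1 + icost e2).+1%N
  end.

Fixpoint rcost (e : rexp) : nat :=
  match e with
  | RZero | ROne => 1%N
  | RGet _ e1 => (icost e1).+1
  | RAdd e1 e2 | RSub e1 e2 | RMul e1 e2 | RDiv e1 e2 =>
      (rcost e1 + rcost e2).+1%N
  | REval e1 => (rcost e1).+1
  end.

Fixpoint bcost (b : bexp) : nat :=
  match b with
  | ILe e1 e2 => (icost e1 + icost e2).+1%N
  | RLe e1 e2 => (rcost e1 + rcost e2).+1%N
  | BNot b1 => (bcost b1).+1
  | BAnd b1 b2 => (bcost b1 + bcost b2).+1%N
  end.

Section Semantics.
Variables (R : realType) (f : R -> R).
Implicit Types (s : state R).

Fixpoint ieval s (e : iexp) : nat :=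
  match e with
  | INum k => k
  | IGet x e1 => imem s x (ieval s e1)
  | IAdd e1 e2 => (ieval s e1 + ieval s e2)%N
  | ISub e1 e2 => (ieval s e1 - ieval s e2)%N
  end.

Fixpoint reval s (e : rexp) : R :=
  match e with
  | RZero => 0
  | ROne => 1
  | RGet x e1 => rmem s x (ieval s e1)
  | RAdd e1 e2 => reval s e1 + reval s e2
  | RSub e1 e2 => reval s e1 - reval s e2
  | RMul e1 e2 => reval s e1 * reval s e2
  | RDiv e1 e2 => reval s e1 / reval s e2
  | REval e1 => f (reval s e1)
  end.

Fixpoint beval s (b : bexp) : bool :=
  match b with
  | ILe e1 e2 => (ieval s e1 <= ieval s e2)%N
  | RLe e1 e2 => reval s e1 <= reval s e2
  | BNot b1 => ~~ beval s b1
  | BAnd b1 b2 => beval s b1 && beval s b2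
  end.

(* [exec c s T s']: from s, the command c halts in s' after T time units.     *)
Inductive exec : cmd -> state R -> nat -> state R -> Prop :=
  | ExecSkip s : exec Skip s 1%N s
  | ExecISet s x e v :
      exec (ISet x e v) s (icost e + icost v).+1%N
           (State (upd (imem s) x (ieval s e) (ieval s v)) (rmem s))
  | ExecRSet s x e v :
      exec (RSet x e v) s (icost e + rcost v).+1%N
           (State (imem s) (upd (rmem s) x (ieval s e) (reval s v)))
  | ExecSeq c1 c2 s s1 s2 T1 T2 :
      exec c1 s T1 s1 -> exec c2 s1 T2 s2 ->
      exec (Seq c1 c2) s (T1 + T2)%N s2
  | ExecIf b c1 c2 s T s1 :
      exec (if beval s b then c1 else c2) s T s1 ->
      exec (If b c1 c2) s (bcost b + T)%N s1
  | ExecWhileFalse b c s :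
      ~~ beval s b -> exec (While b c) s (bcost b) s
  | ExecWhileTrue b c s s1 s2 T1 T2 :
      beval s b -> exec c s T1 s1 -> exec (While b c) s1 T2 s2 ->
      exec (While b c) s (bcost b + T1 + T2)%N s2.

Lemma exec_det c s T1 s1 T2 s2 :
  exec c s T1 s1 -> exec c s T2 s2 -> T1 = T2 /\ s1 = s2.
Proof.
move=> E1; elim: E1 T2 s2 => {c s T1 s1}.
- by move=> s T2 s2 E; inversion E.
- by move=> s x e v T2 s2 E; inversion E.
- by move=> s x e v T2 s2 E; inversion E.
- move=> c1 c2 s s1 s2 T1 T2 _ IH1 _ IH2 T' s' E; inversion E; subst.
  match goal with H : exec c1 _ _ _ |- _ => case: (IH1 _ _ H) end.
  move=> *; subst.
  by match goal with H : exec c2 _ _ _ |- _ => case: (IH2 _ _ H) => -> -> end.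
- move=> b c1 c2 s T s1 _ IH T' s' E; inversion E; subst.
  by match goal with H : exec _ _ _ _ |- _ => case: (IH _ _ H) => -> -> end.
- move=> b c s nb T' s' E; inversion E; subst => //.
  by rewrite H1 in nb.
- move=> b c s s1 s2 T1 T2 hb _ IH1 _ IH2 T' s' E; inversion E; subst.
    by match goal with H : is_true (~~ _) |- _ => rewrite hb in H end.
  match goal with H : exec c _ _ _ |- _ => case: (IH1 _ _ H) end.
  move=> *; subst.
  by match goal with H : exec (While b c) _ _ _ |- _ =>
    case: (IH2 _ _ H) => -> -> end.
Qed.

End Semantics.

(* Memory layout on input: natural array 0 holds n and t, natural array 1 the *)
(* block sizes |N 0|, |N 1|, ..., natural array 2 the permutation, and real   *)
(* array 0 the vector a; every other cell is 0.                               *)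
Definition input_state (R : realType) (n t : nat) (a : 'I_n -> R)
    (N : 'I_t -> {set 'I_n}) (d : {perm 'I_n}) : state R :=
  State
    (fun x i => match x with
       | 0 => nth 0%N [:: n; t] i
       | 1 => oapp (fun k : 'I_t => #|N k|) 0%N (insub i)
       | 2 => oapp (fun j : 'I_n => val (d j)) 0%N (insub i)
       | _ => 0%N
       end)
    (fun x i => if x is 0 then oapp a 0 (insub i) else 0).

(* The result is read in real array 1.                                        *)
Definition output (R : realType) (s : state R) (i : nat) : R := rmem s 1 i.

(* Main.v *)
(** Call the records of the prefix of length m of the permutation the largest
    element of each block among its first m elements. Every partial transversal
    S satisfies eta(S) <= f(a(S)) by definition of its last lifted element, and
    the set of records of each prefix is tight for this inequality. For an
    element i let q be the first lifted element of its block with q >= i, and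
    let B be the records, outside the block of i, of the prefix preceding q.
    Then B is optimal in the definition of eta_i: a competitor S with
    a(S) <= a(B) is beaten by the concavity of f together with tightness of B
    completed by the previous record of the block, which is at most a_i; a
    competitor with a(S) >= a(B) is beaten using tightness of B with q instead,
    since a_q >= a_i. Hence eta_i = f(a_i + a(B)) - eta(B), and for each i one
    scan finds q and a backward scan over the elements sums a and eta over B,
    the first eligible element met in each block being its record. *)
Require Import Defs.
From mathcomp Require Import all_boot all_order all_algebra.
From mathcomp Require Import all_fingroup.
From mathcomp Require Import reals.
From mathcomp Require Import zify ring lra.

Set Implicit Arguments.
Unset Strict Implicit.
Unset Printing Implicit Defensive.

Import Order.TTheory GRing.Theory Num.Theory.
Local Open Scope ring_scope.

(** * Increments of a concave function *)

(** [x + v] and [y + u] are the convex combinations of [x + u] and [y + v] with the weights [s] and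
    [1 - s] interchanged, so two instances of concavity add up to the claim. *)
Lemma concave_exchange (R : realType) (f : R -> R) (x y u v : R) :
  concave_function f -> x <= y -> u <= v ->
  f (y + v) - f (y + u) <= f (x + v) - f (x + u).
Proof.
move=> /concave_functionP cf; rewrite le_eqVlt => /predU1P[->//|xy] uv.
set D := (y - x) + (v - u); have D0 : 0 < D by rewrite /D; lra.
pose s := (v - u) / D; have s01 : 0 <= s <= 1.
  by rewrite /s divr_ge0 ?ler_pdivrMr ?mul1r /D /=; lra.
have sD : s * D = v - u by rewrite /s mulfVK// gt_eqF.
have := cf s (x + u) (y + v) s01; have := cf s (y + v) (x + u) s01.
have -> : s * (y + v) + (1 - s) * (x + u) = x + u + s * D.
  by rewrite /D; ring.
have -> : s * (x + u) + (1 - s) * (y + v) = y + v - s * D.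
  by rewrite /D; ring.
rewrite sD.
have -> : x + u + (v - u) = x + v by ring.
have -> : y + v - (v - u) = y + u by ring.
lra.
Qed.

(** * Closed formula for the lifting coefficients *)

Section LiftingFormula.
Variables (R : realType) (n t : nat) (f : R -> R) (a eta : 'I_n -> R).
Variables (blk : 'I_n -> 'I_t) (tau : 'I_n -> nat).
Hypothesis cf : concave_function f.
Hypothesis f0 : f 0 = 0.
Hypothesis a_ge0 : forall i, 0 <= a i.
Hypothesis a_asc : forall i j : 'I_n, blk i = blk j -> (i <= j)%N -> a i <= a j.
Hypothesis tau_inj : injective tau.

Definition partial_transversal (S : {set 'I_n}) : Prop := {in S &, injective blk}.

(** [eta_le] and [eta_ge] jointly encode the recursive minimum, with [tau] as lifting time and
    partial transversals as competitors. *)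
Hypothesis eta_le : forall i (S : {set 'I_n}),
  partial_transversal S -> i \in S -> {in S, forall x, (tau x <= tau i)%N} ->
  eta i <= f (\sum_(x in S) a x) - \sum_(x in S :\ i) eta x.
Hypothesis eta_ge : forall i (v : R),
  (forall S : {set 'I_n}, partial_transversal S -> i \in S ->
     {in S, forall x, (tau x <= tau i)%N} ->
     v <= f (\sum_(x in S) a x) - \sum_(x in S :\ i) eta x) ->
  v <= eta i.

Lemma transversal_sub (S S' : {set 'I_n}) :
  {subset S' <= S} -> partial_transversal S -> partial_transversal S'.
Proof. by move=> sub tS x y /sub xS /sub yS; apply: tS. Qed.

Lemma transversalU (S S' : {set 'I_n}) :
  partial_transversal S -> partial_transversal S' ->
  (forall x y, x \in S -> y \in S' -> blk x <> blk y) -> partial_transversal (S :|: S').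
Proof.
move=> tS tS' SS' x y; rewrite !inE => /orP[xS|xS] /orP[yS|yS] e.
- exact: tS.
- by case: (SS' _ _ xS yS).
- by case: (SS' _ _ yS xS).
- exact: tS'.
Qed.

Lemma sumU (S S' : {set 'I_n}) (g : 'I_n -> R) :
  (forall x y, x \in S -> y \in S' -> blk x <> blk y) ->
  \sum_(x in S :|: S') g x = \sum_(x in S) g x + \sum_(x in S') g x.
Proof.
move=> SS'; rewrite -bigU/=; first by apply: eq_bigl => x; rewrite !inE.
rewrite -setI_eq0; apply/eqP/setP => x; rewrite !inE.
by apply/andP => -[xS] /(SS' _ _ xS).
Qed.

Lemma transversal_valid (S : {set 'I_n}) :
  partial_transversal S -> \sum_(x in S) eta x <= f (\sum_(x in S) a x).
Proof.
move=> tS; have [->|/set0Pn[x0 x0S]] := eqVneq S set0.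
  by rewrite !big_set0 f0.
case: (arg_maxnP tau x0S) => i iS imax.
by rewrite [leLHS](big_setD1 i)//= -lerBrDr; apply: eta_le.
Qed.

(** Sending each [x] of [S'] to a dominating element of its block is injective, because [S'] is a
    transversal, and does not decrease [a]; the rest of [S] contributes a nonnegative amount. *)
Lemma transversal_dominated (S S' : {set 'I_n}) :
  partial_transversal S' ->
  (forall x, x \in S' -> exists2 y, y \in S & blk y = blk x /\ (x <= y)%N) ->
  \sum_(x in S') a x <= \sum_(x in S) a x.
Proof.
move=> tS' dom; pose g x := odflt x [pick y in S | (blk y == blk x) && (x <= y)%N].
have gP x : x \in S' -> [/\ g x \in S, blk (g x) = blk x & (x <= g x)%N].
  move=> /dom[y yS [yx xy]]; rewrite /g; case: pickP => [z /and3P[? /eqP]//|].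
  by move=> /(_ y); rewrite yS yx eqxx xy.
have ginj : {in S' &, injective g}.
  move=> x y xS yS e; apply: tS' => //.
  by have [_ <- _] := gP _ xS; have [_ <- _] := gP _ yS; rewrite e.
apply: (@le_trans _ _ (\sum_(x in S') a (g x))).
  by apply: ler_sum => x /gP[_ e xg]; apply: a_asc.
rewrite -(big_imset a)//= [leRHS](big_setID (g @: S'))/=.
rewrite (_ : S :&: g @: S' = g @: S') ?lerDl ?sumr_ge0//.
by apply/setIidPr/subsetP => _ /imsetP[x /gP[? _ _] ->].
Qed.

Definition records (m : nat) : {set 'I_n} :=
  [set x | (tau x < m)%N &
     [forall y : 'I_n, (blk y == blk x) && (x < y)%N ==> (m <= tau y)%N]].

Lemma recordsP m x :
  reflect ((tau x < m)%N /\
           forall y : 'I_n, blk y = blk x -> (x < y)%N -> (m <= tau y)%N)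
          (x \in records m).
Proof.
rewrite inE; apply: (iffP andP) => -[-> H]; split=> //.
  by move=> y e xy; have /forallP/(_ y) := H; rewrite e eqxx xy.
by apply/forallP => y; apply/implyP => /andP[/eqP e xy]; apply: H.
Qed.

Lemma records_transversal m : partial_transversal (records m).
Proof.
move=> x y /recordsP[xm xmax] /recordsP[ym ymax] e.
have [xy|yx|/val_inj//] := ltngtP x y.
  by have := xmax _ (esym e) xy; rewrite leqNgt ym.
by have := ymax _ e yx; rewrite leqNgt xm.
Qed.

Lemma records_dom m x : (tau x < m)%N ->
  exists2 y, y \in records m & blk y = blk x /\ (x <= y)%N.
Proof.
move=> xm; pose P := [pred y : 'I_n | (blk y == blk x) && (tau y < m)%N].
have Px : P x by rewrite /= eqxx.
case: (arg_maxnP (fun y : 'I_n => y : nat) Px) => y /andP[/eqP yx ym] ymax.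
exists y; last by split=> //; exact: ymax.
apply/recordsP; split=> // z zy yz; rewrite leqNgt; apply/negP => zm.
by have := ymax z; rewrite /= zy yx eqxx zm leqNgt yz => /(_ isT).
Qed.

Definition other_records m i : {set 'I_n} :=
  [set x in records m | blk x != blk i].

Definition tight (S : {set 'I_n}) : Prop :=
  \sum_(x in S) eta x = f (\sum_(x in S) a x).

(* Concavity compares the tight set [P :|: B] with the valid set [P :|: S].   *)
Lemma exchange (P B S : {set 'I_n}) (w : R) :
  (forall x y, x \in P -> y \in B -> blk x <> blk y) ->
  (forall x y, x \in P -> y \in S -> blk x <> blk y) ->
  partial_transversal (P :|: S) -> tight (P :|: B) ->
  (\sum_(x in P) a x <= w /\ \sum_(x in S) a x <= \sum_(x in B) a x) \/
  (w <= \sum_(x in P) a x /\ \sum_(x in B) a x <= \sum_(x in S) a x) ->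
  f (w + \sum_(x in B) a x) - \sum_(x in B) eta x <=
  f (w + \sum_(x in S) a x) - \sum_(x in S) eta x.
Proof.
move=> PB PS /transversal_valid; rewrite /tight !sumU//.
by move=> valid eqB [] [] wP BS;
  have := concave_exchange cf wP BS; lra.
Qed.

Lemma records_split l i :
  records l = [set x in records l | blk x == blk i] :|: other_records l i.
Proof.
apply/setP => x; rewrite !inE.
by case: (blk x == blk i); rewrite ?andbT ?andbF ?orbF. Qed.

(** The disjunction lets the lemma serve twice: with [l = tau i], tightness of [records l] is
    enough, which drives the induction in [records_tight]; the case of [q] uses tightness one step
    later and yields the general formula. *)
Lemma lifting_formula i l :
  (forall x : 'I_n, blk x = blk i -> (i <= x)%N -> (l <= tau x)%N) ->
  tight (records l) ->
  (l = tau i \/ exists q : 'I_n, [/\ blk q = blk i, (i <= q)%N, tau q = l,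
      (l <= tau i)%N & tight (q |: other_records l i)]) ->
  eta i = f (a i + \sum_(x in other_records l i) a x)
          - \sum_(x in other_records l i) eta x.
Proof.
move=> imax tl lq; set B := other_records l i.
have li : (l <= tau i)%N by case: lq => [->//|[q [_ _ _ ->]]].
have Bi x : x \in B -> blk i <> blk x.
  by rewrite inE => /andP[_ /eqP xi] e; apply: xi.
have Bt x : x \in B -> (tau x < l)%N.
  by rewrite inE => /andP[/recordsP[]].
have tB : partial_transversal B.
  by apply: transversal_sub (@records_transversal l) => x; rewrite inE => /andP[].
have dlt (S : {set 'I_n}) g : i \in S ->
    \sum_(x in S) g x = g i + \sum_(x in S :\ i) g x :> R.
  by move=> iS; rewrite (big_setD1 i).
(* Upper bound: [i |: B] is itself a competitor, since [B] is lifted before [l <= tau i]. *)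
apply/eqP; rewrite eq_le; apply/andP; split.
  have iB : i \notin B by apply/negP => /Bi.
  have := @eta_le i (i |: B); rewrite big_setU1//= setU1K//; apply.
  - apply: transversalU => //; first by move=> x y /set1P-> /set1P->.
    by move=> x y /set1P->; apply: Bi.
  - by rewrite !inE eqxx.
  - by move=> x /setU1P[->//|/Bt xl]; rewrite ltnW// (leq_trans xl).
apply: eta_ge => S tS iS Si; rewrite (dlt S)//.
have Sk x : x \in S :\ i -> blk i <> blk x.
  by rewrite !inE => /andP[/eqP xi xS] e; apply: xi; apply: tS.
have tSi : partial_transversal (S :\ i).
  by apply: transversal_sub tS => x; rewrite inE => /andP[].
pose P : {set 'I_n} := [set x in records l | blk x == blk i].
have PE x : x \in P -> x \in records l /\ blk x = blk i.
  by rewrite inE => /andP[? /eqP].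
have tP : partial_transversal P.
  by apply: transversal_sub (@records_transversal l) => x /PE[].
have PB x y : x \in P -> y \in B -> blk x <> blk y.
  by move=> /PE[_ ->]; apply: Bi.
have PS x y : x \in P -> y \in S :\ i -> blk x <> blk y.
  by move=> /PE[_ ->]; apply: Sk.
(* By [imax], a record of the block of [i] before time [l] has an index below [i]. *)
have Pi : \sum_(x in P) a x <= a i.
  rewrite -(big_set1 +%R i a); apply: transversal_dominated => // x /PE[xl xi].
  exists i; rewrite ?inE//; split=> //.
  have /recordsP[xl' _] := xl; rewrite leqNgt; apply/negP => ix.
  by have := imax _ xi (ltnW ix); rewrite leqNgt xl'.
have [SB|BS] := leP (\sum_(x in S :\ i) a x) (\sum_(x in B) a x).
  apply: (@exchange P) => //; first exact: transversalU.
    by rewrite -records_split.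
  by left.
(* When [l = tau i], every element of [S :\ i] is lifted before [l], hence dominated by a record in
   [B], so [S :\ i] cannot outweigh [B]. *)
case: lq => [le|[q [qi iq _ _ tq]]].
  exfalso; move: BS; apply/negP; rewrite -leNgt; apply: transversal_dominated => //.
  move=> x xS; have xl : (tau x < l)%N.
    move: (xS); rewrite in_setD1 => /andP[xi /Si]; rewrite leq_eqVlt le => /predU1P[|//].
    by move=> /tau_inj xe; rewrite xe eqxx in xi.
  have [y yl [yx xy]] := records_dom xl; exists y => //.
  by rewrite inE yl yx; apply/eqP => e; apply: (Sk _ xS).
have qS x y : x \in [set q] -> y \in S :\ i -> blk x <> blk y.
  by move=> /set1P->; rewrite qi; apply: Sk.
apply: (@exchange [set q]) => //.
- by move=> x y /set1P->; rewrite qi; apply: Bi.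
- by apply: transversalU => // x y /set1P-> /set1P->.
- by right; rewrite big_set1 (ltW BS) a_asc.
Qed.

Lemma records_succ (q : 'I_n) :
  (forall x : 'I_n, blk x = blk q -> (q < x)%N -> (tau q < tau x)%N) ->
  records (tau q).+1 = q |: other_records (tau q) q.
Proof.
move=> qmax; apply/setP => x; rewrite in_setU1 [in RHS]inE.
have [->|xq] /= := eqVneq x q.
  by apply/recordsP; split=> // y; apply: qmax.
have txq : (tau x < (tau q).+1)%N = (tau x < tau q)%N.
  by rewrite ltnS leq_eqVlt (inj_eq tau_inj) (negPf xq).
apply/recordsP/andP => [[xl xmax]|[/recordsP[xl xmax] bxq]].
  split; first by apply/recordsP; rewrite -txq; split=> // y yx xy; apply/ltnW/xmax.
  apply/eqP => e; have [lt|lt|/val_inj ee] := ltngtP x q.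
  - by have := xmax _ (esym e) lt; rewrite ltnn.
  - by have := qmax _ e lt; rewrite ltnNge -ltnS xl.
  - by rewrite ee eqxx in xq.
split; first by rewrite txq.
move=> y yx xy; rewrite ltn_neqAle xmax// andbT (inj_eq tau_inj).
by apply: contraNneq bxq => ->; rewrite yx.
Qed.

(** Induction on [m]. If the element lifted at time [m] exceeds all earlier ones of its block, it
    replaces the old record there, and [lifting_formula] at this element is exactly tightness;
    otherwise the records do not change. *)
Lemma records_tight m : tight (records m).
Proof.
elim: m => [|m IH].
  have -> : records 0 = set0 by apply/setP => x; rewrite !inE.
  by rewrite /tight !big_set0 f0.
have skip : (forall q, tau q = m -> exists x : 'I_n,
    [/\ blk x = blk q, (q < x)%N & (tau x < m)%N]) -> records m.+1 = records m.
  move=> noq; apply/setP => x; apply/recordsP/recordsP => -[xm xmax].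
    split; last by move=> y yx xy; apply/ltnW/xmax.
    move: xm; rewrite ltnS leq_eqVlt => /predU1P[/noq[y [yx xy]]|//].
    by rewrite ltnNge ltnW// xmax.
  split; first exact: ltnW.
  move=> y yx xy; rewrite ltn_neqAle xmax// andbT.
  apply/eqP => /esym/noq[z [zy yz]].
  by rewrite ltnNge xmax// ?zy// (ltn_trans xy).
have [/existsP[q /andP[/eqP qm /forallP qmax]]|] :=
  boolP [exists q, (tau q == m) &&
    [forall x : 'I_n, (blk x == blk q) && (q < x)%N ==> (m <= tau x)%N]].
  have qmax' x : blk x = blk q -> (q < x)%N -> (m <= tau x)%N.
    by move=> e qx; have := qmax x; rewrite e eqxx qx.
  have sm : records m.+1 = q |: other_records m q.
    rewrite -qm; apply: records_succ => x xq qx.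
    rewrite ltn_neqAle qm qmax'// andbT -qm (inj_eq tau_inj).
    by apply: contraTneq qx => ->; rewrite ltnn.
  have qB : q \notin other_records m q by rewrite inE eqxx andbF.
  rewrite sm /tight !big_setU1//= (@lifting_formula q m) ?subrK//; last by left.
  move=> x xq; rewrite leq_eqVlt => /predU1P[/val_inj<-|]; first by rewrite qm.
  exact: qmax'.
move=> /existsPn noq; rewrite skip// => q qm.
have := noq q; rewrite qm eqxx /= => /forallPn[x].
by rewrite negb_imply -ltnNge => /andP[/andP[/eqP xq qx] xm]; exists x.
Qed.

(** For [q] different from [i], the set [q |: other_records (tau q) i] is [records (tau q).+1],
    because [q] becomes the record of its block when it is lifted. *)
Lemma lifting_formula_tau (i q : 'I_n) :
  blk q = blk i -> (i <= q)%N ->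
  (forall x : 'I_n, blk x = blk i -> (i <= x)%N -> (tau q <= tau x)%N) ->
  eta i = f (a i + \sum_(x in other_records (tau q) i) a x)
          - \sum_(x in other_records (tau q) i) eta x.
Proof.
move=> qi iq qmin; apply: lifting_formula => //; first exact: records_tight.
have [->|_] := eqVneq i q; [by left | right; exists q; split=> //].
  exact: qmin.
rewrite (_ : other_records _ i = other_records (tau q) q).
  rewrite -records_succ; first exact: records_tight.
  move=> x xq qx; rewrite ltn_neqAle qmin ?xq ?(leq_trans iq) ?(ltnW qx)// andbT.
  by rewrite (inj_eq tau_inj); apply: contraTneq qx => ->; rewrite ltnn.
by apply/setP => x; rewrite !inE qi.
Qed.

End LiftingFormula.

(** * Running time of loop-free code and of counting loops *)

Fixpoint loop_free (c : cmd) : bool :=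
  match c with
  | While _ _ => false
  | Seq c1 c2 | If _ c1 c2 => loop_free c1 && loop_free c2
  | _ => true
  end.

Fixpoint max_cost (c : cmd) : nat :=
  match c with
  | Skip => 1
  | ISet _ e v => (icost e + icost v).+1
  | RSet _ e v => (icost e + rcost v).+1
  | Seq c1 c2 => max_cost c1 + max_cost c2
  | If b c1 c2 => bcost b + maxn (max_cost c1) (max_cost c2)
  | While _ _ => 0
  end.

Definition var (v : nat) : iexp := IGet v (INum 0).

Definition set_var (v : nat) (e : iexp) : cmd := ISet v (INum 0) e.

Definition For (v : nat) (body : cmd) : cmd :=
  Seq (set_var v (INum 0))
    (While (ILe (IAdd (var v) (INum 1)) (var 0))
       (Seq body (set_var v (IAdd (var v) (INum 1))))).

(** Each round costs [B], plus 7 for the test and 6 for the increment; the extra round covers the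
    initialization (3) and the last, failing test (7). *)
Definition for_cost (n B : nat) : nat := (n.+1 * (B + 13))%N.

Section Runs.
Variables (R : realType) (f : R -> R).
Implicit Types (s : state R) (Q : state R -> Prop).

(** An evaluator that yields the effect of loop-free commands by computation; [While] gets a default
    value, excluded by [loop_free] in [runs_run]. *)
Fixpoint run (c : cmd) s : state R :=
  match c with
  | ISet x e v => State (upd (imem s) x (ieval s e) (ieval s v)) (rmem s)
  | RSet x e v => State (imem s) (upd (rmem s) x (ieval s e) (reval f s v))
  | Seq c1 c2 => run c2 (run c1 s)
  | If b c1 c2 => if beval f s b then run c1 s else run c2 s
  | Skip | While _ _ => s
  end.

Definition runs (c : cmd) s (B : nat) Q : Prop :=
  exists T s', [/\ exec f c s T s', (T <= B)%N & Q s'].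

Lemma runs_run c s Q : loop_free c -> Q (run c s) -> runs c s (max_cost c) Q.
Proof.
elim: c s Q => //=.
- by move=> s Q _ q; exists 1%N, s; split=> //; constructor.
- by move=> x e v s Q _ q; do 2 eexists; split; [constructor|exact: leqnn|].
- by move=> x e v s Q _ q; do 2 eexists; split; [constructor|exact: leqnn|].
- move=> c1 IH1 c2 IH2 s Q /andP[l1 l2] q.
  have [T1 [s1 [E1 le1 e1]]] := IH1 s (eq (run c1 s)) l1 erefl; subst s1.
  have [T2 [s2 [E2 le2 q2]]] := IH2 _ _ l2 q.
  by exists (T1 + T2)%N, s2; split=> //; [econstructor; eauto|exact: leq_add].
- move=> b c1 IH1 c2 IH2 s Q /andP[l1 l2] q.
  have [T [s' [E le q']]] : runs (if beval f s b then c1 else c2) s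
      (maxn (max_cost c1) (max_cost c2)) Q.
    case: (beval f s b) q => q.
      by have [T [s' [E le q']]] := IH1 _ _ l1 q; exists T, s'; rewrite leq_max le.
    by have [T [s' [E le q']]] := IH2 _ _ l2 q; exists T, s'; rewrite leq_max le orbT.
  by exists (bcost b + T)%N, s'; split=> //; [constructor|rewrite leq_add2l].
Qed.

Lemma runs_seq c1 c2 s B1 B2 Q :
  runs c1 s B1 (fun s1 => runs c2 s1 B2 Q) -> runs (Seq c1 c2) s (B1 + B2)%N Q.
Proof.
move=> [T1 [s1 [E1 le1 [T2 [s2 [E2 le2 q]]]]]].
by exists (T1 + T2)%N, s2; split=> //; [econstructor; eauto|exact: leq_add].
Qed.

Lemma runs_weaken c s B Q Q' :
  (forall s', Q s' -> Q' s') -> runs c s B Q -> runs c s B Q'.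
Proof. by move=> QQ' [T [s' [E le q]]]; exists T, s'; split=> //; apply: QQ'. Qed.

(** The invariant is indexed by the number of completed rounds. As [body] preserves the counter, the
    increment amounts to storing the constant [c.+1], the form used in the premise. *)
Lemma runs_for v body n B (I : nat -> state R -> Prop) s :
  (forall c s', I c s' -> imem s' 0 0 = n) ->
  I 0%N (run (set_var v (INum 0)) s) ->
  (forall c s', (c < n)%N -> I c s' -> imem s' v 0 = c ->
     runs body s' B (fun s1 =>
       imem s1 v 0 = c /\ I c.+1 (run (set_var v (INum c.+1)) s1))) ->
  runs (For v body) s (for_cost n B) (I n).
Proof.
move=> In I0 step.
pose W := While (ILe (IAdd (var v) (INum 1)) (var 0))
       (Seq body (set_var v (IAdd (var v) (INum 1)))).
have loop m c s' : (c + m)%N = n -> I c s' -> imem s' v 0 = c ->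
    runs W s' (7 + m * (B + 13)) (I n).
  elim: m c s' => [|m IH] c s' cm Ic vc.
    rewrite addn0 in cm; rewrite cm in Ic vc; exists 7%N, s'; split=> //.
    by apply: ExecWhileFalse; rewrite /= vc (In _ _ Ic) addn1 ltnn.
  have cn : (c < n)%N by rewrite -cm; lia.
  have [T1 [s1 [E1 le1 [v1 I1]]]] := step c s' cn Ic vc.
  have [T2 [s2 [E2 le2 I2]]] := IH c.+1 (run (set_var v (INum c.+1)) s1)
    ltac:(lia) I1 ltac:(by rewrite /= /upd !eqxx).
  exists (7 + (T1 + 6) + T2)%N, s2; split=> //; last lia.
  apply: ExecWhileTrue E2; first by rewrite /= vc (In _ _ Ic) addn1.
  apply: ExecSeq E1 _.
  have -> : run (set_var v (INum c.+1)) s1 =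
            run (set_var v (IAdd (var v) (INum 1))) s1.
    by rewrite /= v1 addn1.
  exact: ExecISet.
have [T [s' [E le q]]] := loop n 0%N _ erefl I0 ltac:(by rewrite /= /upd !eqxx).
exists (3 + T)%N, s'; split=> //; last by rewrite /for_cost; lia.
by apply: ExecSeq E; apply: ExecISet.
Qed.

End Runs.

(** * The lifting algorithm *)

(* Natural arrays: 3 = block of an element, 4 = position of an element in the *)
(* permutation, 5 and 6 = current block and its end, 7 and 8 = loop counters, *)
(* 9 = element being lifted, 10 = l, 11 = 1 + last block met by the backward  *)
(* scan, 12 = element scanned. Real arrays: 2 and 3 = running sums of a and   *)
(* eta over the records.                                                      *)
Definition block_of (e : iexp) : iexp := IGet 3 e.
Definition pos_of (e : iexp) : iexp := IGet 4 e.

Definition IEq (e1 e2 : iexp) : bexp := BAnd (ILe e1 e2) (ILe e2 e1).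

(** Blocks are nonempty, so the current block advances by at most one per element and a conditional
    suffices. The write to array 4 inverts the permutation. *)
Definition init_body : cmd :=
  Seq (If (ILe (var 6) (var 7))
         (Seq (set_var 5 (IAdd (var 5) (INum 1)))
              (set_var 6 (IAdd (var 6) (IGet 1 (var 5)))))
         Skip)
  (Seq (ISet 3 (var 7) (var 5))
       (ISet 4 (IGet 2 (var 7)) (var 7))).

(** A running minimum of lifting positions; it starts at the position of the element being lifted,
    stored by [lift_setup]. *)
Definition find_body : cmd :=
  If (BAnd (ILe (var 9) (var 8))
      (BAnd (IEq (block_of (var 8)) (block_of (var 9)))
            (ILe (pos_of (var 8)) (var 10))))
    (set_var 10 (pos_of (var 8))) Skip.

(** Blocks are consecutive, so remembering the last block that contributed is enough to recognise
    its remaining elements. The shift by 1 lets 0 mean that no block has contributed yet. *)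
Definition sum_body : cmd :=
  Seq (set_var 12 (ISub (var 0) (IAdd (var 8) (INum 1))))
  (If (BAnd (BNot (ILe (var 10) (pos_of (var 12))))
      (BAnd (BNot (IEq (block_of (var 12)) (block_of (var 9))))
            (BNot (IEq (var 11) (IAdd (block_of (var 12)) (INum 1))))))
    (Seq (set_var 11 (IAdd (block_of (var 12)) (INum 1)))
    (Seq (RSet 2 (INum 0) (RAdd (RGet 2 (INum 0)) (RGet 0 (var 12))))
         (RSet 3 (INum 0) (RAdd (RGet 3 (INum 0)) (RGet 1 (var 12))))))
    Skip).

Definition lift_setup : cmd :=
  Seq (set_var 9 (IGet 2 (var 7))) (set_var 10 (var 7)).

Definition sum_setup : cmd :=
  Seq (set_var 11 (INum 0))
  (Seq (RSet 2 (INum 0) RZero) (RSet 3 (INum 0) RZero)).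

Definition lift_store : cmd :=
  RSet 1 (var 9) (RSub (REval (RAdd (RGet 0 (var 9)) (RGet 2 (INum 0))))
                       (RGet 3 (INum 0))).

Definition lift_body : cmd :=
  Seq lift_setup (Seq (For 8 find_body)
  (Seq sum_setup (Seq (For 8 sum_body) lift_store))).

Definition lifting_program : cmd :=
  Seq (set_var 6 (IGet 1 (INum 0)))
  (Seq (For 7 init_body) (For 7 lift_body)).

(** * Loop invariants for lifting one element *)

Section Correctness.
Variables (R : realType) (n t : nat) (f : R -> R) (a : 'I_n -> R).
Variables (N : 'I_t -> {set 'I_n}) (d : {perm 'I_n}) (blk : 'I_n -> 'I_t).
Hypothesis blkE : forall i k, (i \in N k) = (blk i == k).
Hypothesis blk_mono : forall i j : 'I_n, (i <= j)%N -> (blk i <= blk j)%N.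
Implicit Types (s : state R).

Let tau (i : 'I_n) : nat := (d^-1)%g i.
Let eta := lifting_coef f a N d.

Lemma tau_perm j : tau (d j) = j.
Proof. by rewrite /tau permK. Qed.

Lemma tau_injective : injective tau.
Proof. by move=> x y /val_inj/perm_inj. Qed.

Definition loaded s : Prop :=
  [/\ imem s 0 0 = n, forall j : 'I_n, imem s 2 j = d j,
      forall i : 'I_n, imem s 3 i = blk i, forall i : 'I_n, imem s 4 i = tau i &
      forall i : 'I_n, rmem s 0 i = a i].

Definition lifted (j : nat) s : Prop :=
  loaded s /\ forall i : 'I_n, (tau i < j)%N -> rmem s 1 i = eta i.

Definition lifting (j : 'I_n) s : Prop :=
  [/\ lifted j s, imem s 7 0 = j & imem s 9 0 = d j].

Definition found (j : 'I_n) (q : 'I_n) (c : nat) : Prop :=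
  [/\ blk q = blk (d j), (d j <= q)%N, (tau q <= j)%N &
      forall x : 'I_n, blk x = blk (d j) -> (d j <= x < c)%N ->
        (tau q <= tau x)%N].

Lemma run_find j c s : (c < n)%N -> lifting j s -> imem s 8 0 = c ->
  (exists2 q, imem s 10 0 = tau q & found j q c) ->
  let s' := run f find_body s in
  [/\ lifting j s', imem s' 8 0 = c &
      exists2 q, imem s' 10 0 = tau q & found j q c.+1].
Proof.
move=> cn Ls s8 [q s10 [qk iq qj qmin]].
have [[[s00 s2 s3 s4 r0] r1] s7 s9] := Ls.
pose x := Ordinal cn.
have s3c : imem s 3 c = blk x := s3 x; have s4c : imem s 4 c = tau x := s4 x.
rewrite /= s8 s9 s10 !s3 s3c s4c -eqn_leq.
case: ifP => [/and3P[ix /eqP/val_inj xk xq]|].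
  split=> //; exists x => //; split=> //.
    exact: leq_trans qj.
  move=> y yk /andP[iy]; rewrite ltnS leq_eqVlt => /predU1P[yx|yc].
    by rewrite (_ : x = y)//; apply: val_inj.
  by apply: leq_trans xq _; apply: qmin => //; rewrite iy.
move=> no; split=> //; exists q => //; split=> //.
move=> y yk /andP[iy]; rewrite ltnS leq_eqVlt => /predU1P[yx|yc].
  move: no; rewrite (_ : x = y) -?yx ?iy ?yk ?eqxx /=; last exact: val_inj.
  by move=> /negbT; rewrite -ltnNge; apply: ltnW.
by apply: qmin => //; rewrite iy.
Qed.

(** The condition [n <= y + c] selects the last [c] indices, those visited by the backward scan. *)
Definition summed (B : {set 'I_n}) (c : nat) (g : 'I_n -> R) : R :=
  \sum_(y in B | (n <= y + c)%N) g y.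

Lemma summedS (B : {set 'I_n}) (c : nat) (x : 'I_n) g : (x + c.+1)%N = n ->
  summed B c.+1 g = summed B c g + (if x \in B then g x else 0).
Proof.
move=> xc; rewrite /summed addrC big_mkcond (bigD1 x)//= xc leqnn andbT.
congr (_ + _); rewrite big_mkcond [RHS]big_mkcond/=; apply: eq_bigr => y _.
have [->|yx] := eqVneq y x.
  by rewrite /= (_ : (n <= x + c)%N = false) ?andbF//; apply/negbTE; lia.
rewrite /=; congr (if _ && _ then _ else _).
apply/idP/idP; last lia.
move=> ny; rewrite leqNgt; apply/negP => lt; case/eqP: yx; apply: val_inj => /=; lia.
Qed.

(** The marker in array 11 is specified only through elements still to be visited, since it is
    overwritten when a further block contributes. *)
Definition scanned (l : nat) (i : 'I_n) (c : nat) s : Prop :=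
  [/\ rmem s 2 0 = summed (other_records blk tau l i) c a,
      rmem s 3 0 = summed (other_records blk tau l i) c eta &
      forall y : 'I_n, (y + c < n)%N -> blk y != blk i ->
        imem s 11 0 = (blk y).+1 <->
        exists z : 'I_n, [/\ (n <= z + c)%N, blk z = blk y & (tau z < l)%N]].

Lemma run_sum (j : 'I_n) l c s : (c < n)%N -> (l <= j)%N -> lifting j s ->
  imem s 8 0 = c -> imem s 10 0 = l -> scanned l (d j) c s ->
  let s' := run f sum_body s in
  [/\ lifting j s', imem s' 8 0 = c, imem s' 10 0 = l & scanned l (d j) c.+1 s'].
Proof.
move=> cn lj Ls s8 s10 [r2 r3 s11].
have [[[s00 s2 s3 s4 r0] r1] s7 s9] := Ls.
have xn : (n - (c + 1) < n)%N by lia.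
pose x := Ordinal xn.
have xc : (x + c.+1)%N = n by rewrite /=; lia.
(* All larger elements of the block of [x] have been visited, so an eligible [x] is a record exactly
   when its block has not contributed yet: this is the test of the program. *)
have xB : x \in other_records blk tau l (d j) =
    [&& ~~ (l <= tau x)%N, blk x != blk (d j) & imem s 11 0 != (blk x).+1].
  rewrite inE andbC -ltnNge; have [xk|xk] /= := boolP (blk x == _).
    by rewrite andbF.
  have iff11 := s11 x ltac:(rewrite /=; lia) xk.
  apply/recordsP/andP => -[xl H]; split=> //.
    apply/eqP => /iff11[z [zc zx]]; rewrite ltnNge H//=; lia.
  move=> y yx xy; rewrite leqNgt; apply/negP => yl; case/eqP: H; apply/iff11.
  by exists y; split=> //; move: xy => /=; lia.
have s3x : imem s 3 (n - (c + 1)) = blk x := s3 x.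
have s4x : imem s 4 (n - (c + 1)) = tau x := s4 x.
have r0x : rmem s 0 (n - (c + 1)) = a x := r0 x.
rewrite /= /upd /= s00 s8 s9 s10 !s3 s3x s4x -!eqn_leq addn1.
rewrite -xB.
case: ifP => xB'.
  have [/recordsP[xl _] xk] : x \in records blk tau l /\ blk x != blk (d j).
    by move: xB'; rewrite inE => /andP.
  (* The coefficient of [x] is already stored because [tau x < l <= j]. *)
  have r1x : rmem s 1 (n - (c + 1)) = eta x by apply: (r1 x); apply: leq_trans lj.
  split=> //; split; rewrite /= /upd /= ?(summedS _ _ xc) ?xB' ?r2 ?r3 ?r0x ?r1x//.
  move=> y yc yk; split=> [[e]|[z [zc zy zl]]].
    by exists x; split=> //; [rewrite xc|apply: val_inj].
  (* Monotonicity of [blk] squeezes the block of [x] between those of [y] and [z], which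
     coincide. *)
  have yx : (blk y <= blk x)%N by apply: blk_mono; rewrite /=; lia.
  have xz : (blk x <= blk z)%N by apply: blk_mono; rewrite /=; lia.
  by congr _.+1; apply/eqP; rewrite eqn_leq yx -zy xz.
split=> //; split=> //=; rewrite ?(summedS _ _ xc) ?xB' ?addr0//.
move=> y yc yk; have [l11 r11] := s11 y ltac:(lia) yk.
split=> [/l11[z [zc zy zl]]|[z [zc zy zl]]].
  by exists z; split=> //; lia.
have [zc'|zc'] := leqP n (z + c)%N; first by apply: r11; exists z.
have zx : x = z by apply: val_inj => /=; lia.
move/negbT: xB'; rewrite xB zx -ltnNge zl zy yk /= negbK => /eqP e.
by rewrite e.
Qed.


Lemma feasibleP j S : reflect
  [/\ partial_transversal blk S, d j \in S & {in S, forall x, (tau x <= j)%N}]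
  (feasible N d j S).
Proof.
apply: (iffP and3P) => [[/subsetP Sj /forallP card1 jS]|[tS jS Sj]].
  split=> // [x y xS yS e|x /Sj /imsetP[i]]; last by rewrite inE => ? ->; rewrite tau_perm.
  by have /card_le1_eqP := card1 (blk x); apply; rewrite inE blkE ?xS ?yS ?e /=.
split=> //.
  apply/subsetP => x /Sj xj; apply/imsetP; exists ((d^-1)%g x); rewrite ?inE//.
  by rewrite permKV.
apply/forallP => k; apply/card_le1_eqP => x y; rewrite !inE !blkE.
by move=> /andP[xS /eqP xk] /andP[yS /eqP yk]; apply: tS; rewrite ?xk.
Qed.

Lemma lifting_coef_le i (S : {set 'I_n}) :
  partial_transversal blk S -> i \in S -> {in S, forall x, (tau x <= tau i)%N} ->
  eta i <= f (\sum_(x in S) a x) - \sum_(x in S :\ i) eta x.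
Proof.
rewrite -[i](permKV d) tau_perm => tS iS Si.
by rewrite {1}/eta lifting_coefE; apply: (@bigmin_le_cond _ _ _ _ S); apply/feasibleP.
Qed.

Lemma lifting_coef_ge i (v : R) :
  (forall S : {set 'I_n}, partial_transversal blk S -> i \in S ->
     {in S, forall x, (tau x <= tau i)%N} ->
     v <= f (\sum_(x in S) a x) - \sum_(x in S :\ i) eta x) ->
  v <= eta i.
Proof.
rewrite -[i](permKV d) tau_perm => vS.
rewrite /eta lifting_coefE; apply: le_bigmin => [|S /feasibleP[tS iS Si]]; last exact: vS.
(* The iterated minimum starts from the objective of the singleton, which is bounded here. *)
apply: vS => [x y /set1P-> /set1P->//| |x /set1P->]; first exact: set11.
by rewrite tau_perm.
Qed.

Hypothesis cf : concave_function f.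
Hypothesis f0 : f 0 = 0.
Hypothesis a_ge0 : forall i, 0 <= a i.
Hypothesis a_asc : forall i j : 'I_n, blk i = blk j -> (i <= j)%N -> a i <= a j.

Definition lift_cost : nat :=
  (max_cost lift_setup + (for_cost n (max_cost find_body) +
   (max_cost sum_setup + (for_cost n (max_cost sum_body) + max_cost lift_store))))%N.

Lemma runs_lift (j : 'I_n) s : lifted j s -> imem s 7 0 = j ->
  runs f lift_body s lift_cost (fun s1 =>
    imem s1 7 0 = j /\ lifted j.+1 (run f (set_var 7 (INum j.+1)) s1)).
Proof.
move=> [[s00 s2 s3 s4 r0] r1] s7.
apply: runs_seq; apply: runs_run => //; apply: runs_seq.
apply: runs_weaken (runs_for (n := n) (I := fun c s' => lifting j s' /\
    exists2 q, imem s' 10 0 = tau q & found j q c) _ _ _).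
- move=> s1 [[[[t00 t2 t3 t4 u0] u1] t7 t9] [q t10 [qk iq qj qmin]]].
  apply: runs_seq; apply: runs_run => //; apply: runs_seq.
  apply: runs_weaken (runs_for (n := n) (I := fun c s' => [/\ lifting j s',
    imem s' 10 0 = tau q & scanned (tau q) (d j) c s']) _ _ _).
  + move=> s2' [[[[v00 v2 v3 v4 w0] w1] v7 v9] v10 [w2 w3 _]].
    apply: runs_run => //; split=> //; split=> // i; rewrite ltnS leq_eqVlt.
    have sumE g : summed (other_records blk tau (tau q) (d j)) n g =
        \sum_(x in other_records blk tau (tau q) (d j)) g x.
      by apply: eq_bigl => x; rewrite leq_addl andbT.
    have etaE := lifting_formula_tau cf f0 a_ge0 a_asc tau_injective
      lifting_coef_le lifting_coef_ge qk iq.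
    rewrite /= /upd /= v9 w2 w3 w0 !sumE => /orP[/eqP ij|ij].
      have -> : i = d j by rewrite -[i](permKV d); congr (d _); apply: val_inj.
      rewrite eqxx -etaE// => x xk ix; apply: qmin => //.
      by rewrite ix ltn_ord.
    case: eqP => [/val_inj ie|_]; last exact: w1.
    by move: ij; rewrite ie tau_perm ltnn.
  + by move=> c s' [[[[]]]].
  + split=> //; split; rewrite /= /upd /= /summed.
    * by rewrite big_pred0// => x; rewrite addn0 leqNgt ltn_ord andbF.
    * by rewrite big_pred0// => x; rewrite addn0 leqNgt ltn_ord andbF.
    * by move=> y _ _; split=> // -[z [+ _ _]]; rewrite addn0 leqNgt ltn_ord.
  + move=> c s' cn [Ls s10 sc] s8; apply: runs_run => //.
    by have [] := run_sum cn qj Ls s8 s10 sc.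
- by move=> c s' [[[[]]]].
- split; first by split=> //=; rewrite /upd /= s7 s2.
  exists (d j); first by rewrite /= /upd /= s7 tau_perm.
  by split=> //; [rewrite tau_perm|move=> x _; rewrite ltn0 andbF].
- move=> c s' cn [Ls sq] s8; apply: runs_run => //.
  by have [] := run_find cn Ls s8 sq.
Qed.

End Correctness.

(** * Block indices and the initialization pass *)

Section Blocks.
Variables (n t : nat) (N : 'I_t -> {set 'I_n}).
Hypothesis part : consecutive_partition N.

(** Extended by 0 beyond the last block, like array 1 of the input, so that [block_endS] holds for
    all [k]. *)
Definition block_size (k : nat) : nat := oapp (fun k : 'I_t => #|N k|) 0%N (insub k).

Lemma block_endS k : block_end N k.+1 = (block_end N k + block_size k)%N.
Proof.
rewrite /block_size /block_end; case: insubP => [k' _ kk'|] /=; last first.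
  rewrite -leqNgt => tk; rewrite addn0; apply: eq_bigl => j.
  by rewrite ltnS !(leq_trans (ltnW (ltn_ord j)) tk) (leq_trans (ltn_ord j) tk).
rewrite (bigD1 k')/= ?kk'// addnC; congr (_ + _)%N; apply: eq_bigl => j.
by rewrite -val_eqE/= kk' ltnS ltn_neqAle andbC.
Qed.

Lemma block_end_mono k l : (k <= l)%N -> (block_end N k <= block_end N l)%N.
Proof.
move=> /subnK <-; elim: (l - k)%N => // m; rewrite addSn block_endS.
by move=> /leq_trans; apply; apply: leq_addr.
Qed.

Lemma block_size_gt0 k : (k < t)%N -> (0 < block_size k)%N.
Proof.
move=> kt; rewrite /block_size insubT/= card_gt0; have [/and3P[_ _ no0] _] := part.
by apply: contra no0 => /eqP <-; apply: imset_f.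
Qed.

(** Covering gives an index; its uniqueness comes from the disjointness of the intervals, because a
    partition as a set of sets does not see whether two indices name the same block. *)
Lemma block_index : exists blk : 'I_n -> 'I_t, forall i k, (i \in N k) = (blk i == k).
Proof.
have [/and3P[/eqP cov _ _] Nint] := part.
have ex (i : 'I_n) : exists k, i \in N k.
  have : i \in cover [set N k | k : 'I_t] by rewrite cov inE.
  by move=> /bigcupP[_ /imsetP[k _ ->] ?]; exists k.
exists (fun i => xchoose (ex i)) => i k.
have := xchooseP (ex i); set b := xchoose _ => ib.
apply/idP/eqP => [|<-//]; move: ib; rewrite !Nint => /andP[b1 b2] /andP[k1 k2].
have [bk|kb|/val_inj//] := ltngtP b k.
  by have := leq_trans b2 (leq_trans (block_end_mono bk) k1); rewrite ltnn.
by have := leq_trans k2 (leq_trans (block_end_mono kb) b1); rewrite ltnn.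
Qed.

Variable blk : 'I_n -> 'I_t.
Hypothesis blkE : forall i k, (i \in N k) = (blk i == k).

Lemma block_bounds i : (block_end N (blk i) <= i < block_end N (blk i).+1)%N.
Proof. by have [_ <-] := part; rewrite blkE. Qed.

Lemma block_eq (i : 'I_n) k :
  (block_end N k <= i < block_end N k.+1)%N -> k = blk i.
Proof.
move=> /andP[k1 k2]; have /andP[b1 b2] := block_bounds i.
have [bk|kb|//] := ltngtP (blk i) k.
  by have := leq_trans b2 (leq_trans (block_end_mono bk) k1); rewrite ltnn.
by have := leq_trans k2 (leq_trans (block_end_mono kb) b1); rewrite ltnn.
Qed.

Lemma block_index_mono (i j : 'I_n) : (i <= j)%N -> (blk i <= blk j)%N.
Proof.
move=> ij; rewrite leqNgt; apply/negP => ji.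
have /andP[b1 _] := block_bounds i; have /andP[_ b2] := block_bounds j.
by have := leq_trans b2 (leq_trans (block_end_mono ji) (leq_trans b1 ij)); rewrite ltnn.
Qed.

(** This justifies the test in [init_body]. When [i] is the end of block [k], its own block comes
    later, so [k.+1] is a genuine block; being nonempty, it contains [i]. *)
Lemma block_succ_index (i : 'I_n) k :
  (block_end N k <= i <= block_end N k.+1)%N ->
  ((blk i : nat) = if (block_end N k.+1 <= i)%N then k.+1 else k).
Proof.
move=> /andP[k1 k2]; case: leqP => ki; apply/esym/block_eq; last by rewrite k1.
rewrite ki block_endS /=; have -> : i = block_end N k.+1 :> nat by apply/eqP; rewrite eqn_leq k2.
rewrite -addn1 leq_add2l block_size_gt0//; have /andP[_ b2] := block_bounds i.
apply: leq_ltn_trans (ltn_ord (blk i)); rewrite ltnNge; apply/negP => bk.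
by have := leq_trans b2 (leq_trans (block_end_mono (bk : (blk i).+1 <= k.+1)%N) ki); rewrite ltnn.
Qed.

Variables (R : realType) (f : R -> R) (a : 'I_n -> R) (d : {perm 'I_n}).
Implicit Types (s : state R).

(** The bound [c <= block_end N k.+1] is weak because the block advances only at the start of the
    next round. *)
Definition initialized (c : nat) s : Prop :=
  [/\ [/\ imem s 0 0 = n, forall k, imem s 1 k = block_size k,
      forall j : 'I_n, imem s 2 j = d j & forall i : 'I_n, rmem s 0 i = a i],
      exists k, [/\ imem s 5 0 = k, imem s 6 0 = block_end N k.+1 &
        (block_end N k <= c <= block_end N k.+1)%N],
      forall i : 'I_n, (i < c)%N -> imem s 3 i = blk i &
      forall j : 'I_n, (j < c)%N -> imem s 4 (d j) = j].

Lemma run_init c s : (c < n)%N -> initialized c s -> imem s 7 0 = c ->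
  imem (run f init_body s) 7 0 = c /\ initialized c.+1 (run f init_body s).
Proof.
move=> cn [[s0 s1 s2 r0] [k [s5 s6 kc]] s3 s4] s7.
pose x := Ordinal cn; have blkx := block_succ_index (kc : _ <= x <= _)%N.
have /andP[x1 x2] := block_bounds x.
have s2c : imem s 2 c = d x := s2 x.
have upd3 b (i : 'I_n) : (i < c.+1)%N -> b = blk x :> nat ->
    (if i == c :> nat then b else imem s 3 i) = blk i.
  rewrite ltnS leq_eqVlt; case: eqP => /= [ic _ ->|_ ic _]; last exact: s3.
  by congr (nat_of_ord (blk _)); apply: val_inj.
have upd4 (j : 'I_n) : (j < c.+1)%N ->
    (if d j == d x :> nat then c else imem s 4 (d j)) = j.
  rewrite val_eqE (inj_eq perm_inj) ltnS leq_eqVlt -val_eqE/=.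
  by case: eqP => //= _; apply: s4.
rewrite /= /upd /= s5 s6 s7; case: ifP blkx => kc' blkx.
  rewrite /= s7 addn1 s2c; split=> //; split=> //=.
  - exists k.+1; split=> //; first by rewrite s1 -block_endS.
    by rewrite -blkx; move: x1 x2 => /= x1 x2; rewrite x2 leqW.
  - by move=> i ic; apply: upd3.
rewrite s5 s7 s2c; split=> //; split=> //=.
- exists k; split=> //.
  by rewrite -blkx; move: x1 x2 => /= x1 x2; rewrite x2 leqW.
- by move=> i ic; apply: upd3.
Qed.

Lemma runs_init s : initialized 0 s ->
  runs f (For 7 init_body) s (for_cost n (max_cost init_body))
    (lifted f a N d blk 0).
Proof.
move=> s0; apply: runs_weaken (runs_for (n := n) (I := initialized) _ _ _).
- move=> s' [[t0 t1 t2 u0] _ t3 t4]; split=> //; split=> // i; first exact: t3.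
  by rewrite -{1}[i](permKV d) t4.
- by move=> c s' [[]].
- by [].
- by move=> c s' cn sc s7; apply: runs_run => //; have [] := run_init cn sc s7.
Qed.

End Blocks.

(** * Quadratic time bound and conclusion *)

(** The two scans make [lift_cost n] linear and the outer loop makes the total quadratic; [0 < n]
    absorbs the lower-order terms, and 2000 is a round, non-optimal constant. *)
Lemma program_cost n : (0 < n)%N ->
  (max_cost (set_var 6 (IGet 1 (INum 0))) +
   (for_cost n (max_cost init_body) + for_cost n (lift_cost n)) <= 2000 * n ^ 2)%N.
Proof. by move=> n0; rewrite /lift_cost /for_cost /=; nia. Qed.

Theorem proposition3p10 (R : realType) :
  exists (p : cmd) (C : nat),
    forall (n t : nat) (f : R -> R) (a : 'I_n -> R)
           (N : 'I_t -> {set 'I_n}) (d : {perm 'I_n}),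
      (0 < n)%N -> (0 < t)%N ->
      concave_function f -> f 0 = 0 ->
      (forall i : 'I_n, 0 <= a i) ->
      consecutive_partition N ->
      ascending_in_blocks N a ->
      exists (T : nat) (s : state R),
        [/\ exec f p (input_state a N d) T s,
            (T <= C * n ^ 2)%N &
            forall i : 'I_n, output s i = lifting_coef f a N d i].
Proof.
exists lifting_program, 2000%N => n t f a N d n0 t0 cf f0 a0 part asc.
have [blk blkE] := block_index part.
have a_asc (i j : 'I_n) : blk i = blk j -> (i <= j)%N -> a i <= a j.
  by move=> ij; apply: (asc (blk j)); rewrite blkE ?ij.
suff [T [s [E le sP]]] : runs f lifting_program (input_state a N d)
    (max_cost (set_var 6 (IGet 1 (INum 0))) +
     (for_cost n (max_cost init_body) + for_cost n (lift_cost n)))%N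
    (fun s => forall i : 'I_n, output s i = lifting_coef f a N d i).
  by exists T, s; split=> //; apply: leq_trans le (program_cost n0).
apply: runs_seq; apply: runs_run => //; apply: runs_seq.
apply: runs_weaken (runs_init part blkE f (a := a) (d := d) _); last first.
  split=> //.
  - by split=> //= i; rewrite /upd /= valK.
  - by exists 0%N; split=> //=; rewrite ?block_endS /block_end ?big_pred0.
move=> s s_init.
apply: runs_weaken (runs_for (v := 7) (n := n) (I := lifted f a N d blk) _ s_init _).
- by move=> s' [_ etaE] i; apply: etaE.
- by move=> c s' [[]].
- move=> c s' cn sc s7.
  exact: (runs_lift blkE (block_index_mono part blkE) cf f0 a0 a_asc
            (j := Ordinal cn)).
Qed.
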